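(* Let $A=(a_{ij})=\mathrm{diag}(a_{11},a_{22})$ be a real diagonal $2\times 2$ matrix. The maximum value of $B(\vec{x},\vec{y})=\sum_{i,j=1}^{2}a_{ij}\,\vec{x}_i\cdot\vec{y}_j$ over all unit vectors $\vec{x}_1,\vec{x}_2,\vec{y}_1,\vec{y}_2\in\mathbb{R}^2$ is $\max\{|a_{11}+a_{22}|,\,|a_{11}-a_{22}|\}$.
   Context: Here $\cdot$ is the standard inner product on $\mathbb{R}^2$, and unit vectors are taken with respect to the Euclidean norm. *)

(* Defs.v *)
From mathcomp Require Import all_boot all_order all_algebra.
From mathcomp Require Import classical_sets reals.

Set Implicit Arguments.
Unset Strict Implicit.
Unset Printing Implicit Defensive.

Import Order.TTheory GRing.Theory Num.Theory.

Local Open Scope ring_scope.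
Local Open Scope classical_set_scope.

Definition dotv (R : realType) (n : nat) (u v : 'rV[R]_n) : R :=
  \sum_(k < n) u 0 k * v 0 k.

(* The library norm on row vectors is the sup norm, hence a separate name. *)
Definition enorm (R : realType) (n : nat) (u : 'rV[R]_n) : R :=
  Num.sqrt (dotv u u).

Definition unit_vector (R : realType) (n : nat) (u : 'rV[R]_n) : Prop :=
  enorm u = 1.

Definition bform (R : realType) (m n : nat) (A : 'M[R]_m)
    (x y : 'I_m -> 'rV[R]_n) : R :=
  \sum_(i < m) \sum_(j < m) A i j * dotv (x i) (y j).

Definition is_maximum (R : realType) (S : set R) (b : R) : Prop :=
  S b /\ ubound S b.

(* Main.v *)
(** For diagonal [A] the form is [\sum_i A i i * (x i . y i)], and each inner
    product of unit vectors ranges over [-1, 1], so the maximum is the sum of the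
    [|A i i|], reached by taking every [y i] to be [x i] up to the sign of [A i i].
    Finally [|a| + |d| = max (|a + d|, |a - d|)]. *)

Require Import Defs.
From mathcomp Require Import all_boot all_order all_algebra.
From mathcomp Require Import classical_sets reals.
From mathcomp Require Import lra.

Import Order.TTheory GRing.Theory Num.Theory.

Local Open Scope ring_scope.
Local Open Scope classical_set_scope.

Lemma unit_vectorP (R : realType) (n : nat) (u : 'rV[R]_n) :
  unit_vector u <-> dotv u u = 1.
Proof.
rewrite /unit_vector /enorm; split=> [h|->]; last exact: sqrtr1.
(* [Num.sqrt] is 0 on negative numbers, so the root can be squared away only once its argument is
   known to be nonnegative. *)
have u_ge0 : 0 <= dotv u u by apply: sumr_ge0 => k _; rewrite -expr2 sqr_ge0.
by rewrite -(sqr_sqrtr u_ge0) h expr1n.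
Qed.

Lemma dotvZr (R : realType) (n : nat) (c : R) (u v : 'rV[R]_n) :
  dotv u (c *: v) = c * dotv u v.
Proof. by rewrite /dotv mulr_sumr; apply: eq_bigr => k _; rewrite mxE mulrCA. Qed.

Lemma dotvC (R : realType) (n : nat) (u v : 'rV[R]_n) : dotv u v = dotv v u.
Proof. by apply: eq_bigr => k _; rewrite mulrC. Qed.

Lemma unit_vector_sign (R : realType) (n : nat) (b : bool) (u : 'rV[R]_n) :
  unit_vector u -> unit_vector ((-1) ^+ b *: u).
Proof.
move=> /unit_vectorP u1; apply/unit_vectorP.
by rewrite dotvZr dotvC dotvZr u1 mulr1 -expr2 sqrr_sign.
Qed.

Lemma unit_vector_delta (R : realType) (n : nat) (i : 'I_n) :
  unit_vector (delta_mx 0 i : 'rV[R]_n).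
Proof.
apply/unit_vectorP; rewrite /dotv (bigD1 i) //= big1 ?addr0 => [|k /negPf ki];
  by rewrite !mxE ?ki ?eqxx /= ?mulr1 ?mulr0.
Qed.

(** Cauchy-Schwarz for unit vectors: 1 is the mean of [dotv u u] and [dotv v v], and coordinatewise
    $|ab| \le (a^2+b^2)/2$. *)
Lemma norm_dotv_unit_le1 (R : realType) (n : nat) (u v : 'rV[R]_n) :
  unit_vector u -> unit_vector v -> `|dotv u v| <= 1.
Proof.
move=> /unit_vectorP u1 /unit_vectorP v1.
have -> : 1 = \sum_(k < n) (u 0 k * u 0 k + v 0 k * v 0 k) / 2 :> R.
  by rewrite -mulr_suml big_split /= -!/(dotv _ _) u1 v1; lra.
apply: le_trans (ler_norm_sum _ _ _) _; apply: ler_sum => k _.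
set a := u 0 k; set b := v 0 k.
(* The square of [a + b] gives the lower bound on [a * b], that of [a - b] the upper one. *)
have := sqr_ge0 (a + b); have := sqr_ge0 (a - b).
by rewrite ler_norml sqrrB sqrrD !expr2 => ? ?; apply/andP; split; lra.
Qed.

Lemma bform_diag (R : realType) (m n : nat) (A : 'M[R]_m)
    (x y : 'I_m -> 'rV[R]_n) :
  is_diag_mx A -> bform A x y = \sum_(i < m) A i i * dotv (x i) (y i).
Proof.
move=> /is_diag_mxP hA; apply: eq_bigr => i _.
rewrite (bigD1 i) //= big1 ?addr0 // => j ji.
by rewrite hA ?mul0r // eq_sym.
Qed.

(** The dimension is [n.+1] so that a unit vector exists. *)
Lemma bform_diag_maximum (R : realType) (m n : nat) (A : 'M[R]_m) :
  is_diag_mx A ->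
  is_maximum
    [set b : R | exists x y : 'I_m -> 'rV[R]_n.+1,
       [/\ forall i, unit_vector (x i),
           forall j, unit_vector (y j) &
           b = bform A x y]]
    (\sum_(i < m) `|A i i|).
Proof.
move=> hA; split=> [|_ [x [y [x1 y1 ->]]]].
  pose e : 'rV[R]_n.+1 := delta_mx 0 0.
  have e1 : unit_vector e by exact: unit_vector_delta.
  (* The boolean serves as exponent: the sign is -1 exactly for negative entries, which turns each
     [A i i] into its absolute value. *)
  exists (fun=> e), (fun i => (-1) ^+ (A i i < 0)%R *: e).
  split=> // [j|]; first exact: unit_vector_sign.
  rewrite bform_diag //; apply: eq_bigr => i _.
  by move/unit_vectorP: e1 => e1; rewrite dotvZr e1 mulr1 mulrC normrEsign.
rewrite bform_diag //; apply: ler_sum => i _.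
apply: le_trans (ler_norm _) _.
by rewrite normrM ler_piMr // norm_dotv_unit_le1.
Qed.

(** The triangle inequality bounds both terms of the maximum. Equality is reached by [a + d] when
    the signs agree and by [a - d] when they differ. *)
Lemma maxr_normDB (R : realDomainType) (a d : R) :
  Num.max `|a + d| `|a - d| = `|a| + `|d|.
Proof.
apply: le_anti; rewrite ge_max ler_normD ler_normB le_max /=.
have [a0|a0] := ger0P a; have [d0|d0] := ger0P d; apply/orP.
- by left; rewrite ler_norm.
- by right; rewrite ler_norm.
- by right; rewrite distrC addrC ler_norm.
- by left; rewrite -opprD -normrN ler_norm.
Qed.

Theorem mainTheorem4 (R : realType) (A : 'M[R]_2) (hA : is_diag_mx A) :
  is_maximum
    [set b : R | exists x y : 'I_2 -> 'rV[R]_2,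
       [/\ forall i, unit_vector (x i),
           forall j, unit_vector (y j) &
           b = bform A x y]]
    (Num.max `|A 0 0 + A 1 1| `|A 0 0 - A 1 1|).
Proof.
have := bform_diag_maximum R 2 1 A hA.
(* Unfolding the sum names the second index [lift ord0 ord0], which equals [1] as an ordinal by
   comparing values. *)
by rewrite maxr_normDB big_ord_recl big_ord1 (_ : lift _ _ = 1) //; apply: val_inj.
Qed.
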